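(* Let $I$ be a non-empty set and let $E\subseteq\mathbb{R}^I$ be a linear subspace containing all $e_i$ ($i\in I$), endowed with a complete absolute normalised norm $\|\cdot\|_E$ such that $\operatorname{span}\{e_i:i\in I\}$ is dense in $E$. If $(X_i)_{i\in I}$ is a family of sluacs (resp. luacs) Banach spaces and $E$ is $\mathrm{sluacs}^+$ (resp. $\mathrm{luacs}^+$), then $\bigl[\bigoplus_{i\in I}X_i\bigr]_E$ is also sluacs (resp. luacs).
   Context: Banach spaces are real; $S_X$ denotes the unit sphere of $X$ and $X^*$ its dual. A Banach space $X$ is called - luacs if for every $x\in S_X$, every sequence $(x_n)$ in $S_X$ and every $x^*\in S_{X^*}$: $\|x_n+x\|\to 2$ and $x^*(x_n)\to 1$ imply $x^*(x)=1$; - sluacs if for every $x\in S_X$ and all sequences $(x_n)$ in $S_X$ and $(x_n^* )$ in $S_{X^*}$: $\|x_n+x\|\to 2$ and $x_n^*(x_n)\to 1$ imply $x_n^*(x)\to 1$; - $\mathrm{luacs}^+$ if for every $x\in S_X$, every sequence $(x_n)$ in $S_X$ with $\|x_n+x\|\to 2$ and all $x^*\in S_{X^*}$: $x^*(x_n)\to 1\iff x^*(x)=1$; - $\mathrm{sluacs}^+$ if for every $x\in S_X$, every sequence $(x_n)$ in $S_X$ with $\|x_n+x\|\to 2$ and all sequences $(x_n^* )$ in $S_{X^*}$: $x_n^*(x_n)\to 1\iff x_n^*(x)\to 1$. For a non-empty set $I$, $e_i\in\mathbb{R}^I$ denotes the characteristic function of $\{i\}$. A norm $\|\cdot\|_E$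 on a subspace $E$ of $\mathbb{R}^I$ (with all $e_i\in E$) is absolute if whenever $(a_i)_{i\in I}\in E$, $(b_i)_{i\in I}\in\mathbb{R}^I$ and $|a_i|=|b_i|$ for all $i\in I$, then $(b_i)_{i\in I}\in E$ and $\|(a_i)_{i\in I}\|_E=\|(b_i)_{i\in I}\|_E$; it is normalised if $\|e_i\|_E=1$ for every $i\in I$. For a family $(X_i)_{i\in I}$ of Banach spaces, the absolute sum with respect to $E$ is $\bigl[\bigoplus_{i\in I}X_i\bigr]_E=\{(x_i)_{i\in I}\in\prod_{i\in I}X_i:(\|x_i\|)_{i\in I}\in E\}$ with the norm $\|(x_i)_{i\in I}\|_E=\|(\|x_i\|)_{i\in I}\|_E$; it is a Banach space. *)

(* Defs.v *)
From HB Require Import structures.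
From mathcomp Require Import all_boot all_order all_algebra.
From mathcomp Require Import all_classical all_reals all_analysis.
From mathcomp Require Import ring lra.

Set Implicit Arguments.
Unset Strict Implicit.
Unset Printing Implicit Defensive.

Import Order.TTheory GRing.Theory Num.Theory.
Import numFieldNormedType.Exports.

Local Open Scope classical_set_scope.
Local Open Scope ring_scope.

Section AlmostConvexity.
Context {R : realType}.

Definition unit_sphere {X : normedModType R} : set X := [set x | `|x| = 1].

Definition dual_norm {X : normedModType R} (f : {linear X -> R^o}) : R :=
  sup [set `|f x| | x in [set x : X | `|x| <= 1]].

(* Continuity has to be required: on an unbounded set, [sup] is a junk value. *)
Definition dual_unit_sphere {X : normedModType R} : set {linear X -> R^o} :=
  [set f : {linear X -> R^o} | continuous f /\ dual_norm f = 1].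

Definition luacs (X : completeNormedModType R) : Prop :=
  forall (x : X) (u : nat -> X) (f : {linear X -> R^o}),
    unit_sphere x -> (forall n, unit_sphere (u n)) -> dual_unit_sphere f ->
    `|u n + x| @[n --> \oo] --> (2 : R) ->
    f (u n) @[n --> \oo] --> (1 : R) ->
    f x = 1.

Definition sluacs (X : completeNormedModType R) : Prop :=
  forall (x : X) (u : nat -> X) (f : nat -> {linear X -> R^o}),
    unit_sphere x -> (forall n, unit_sphere (u n)) ->
    (forall n, dual_unit_sphere (f n)) ->
    `|u n + x| @[n --> \oo] --> (2 : R) ->
    f n (u n) @[n --> \oo] --> (1 : R) ->
    f n x @[n --> \oo] --> (1 : R).

Definition luacs_plus (X : completeNormedModType R) : Prop :=
  forall (x : X) (u : nat -> X),
    unit_sphere x -> (forall n, unit_sphere (u n)) ->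
    `|u n + x| @[n --> \oo] --> (2 : R) ->
    forall f : {linear X -> R^o}, dual_unit_sphere f ->
      ((f (u n) @[n --> \oo] --> (1 : R)) <-> f x = 1).

Definition sluacs_plus (X : completeNormedModType R) : Prop :=
  forall (x : X) (u : nat -> X),
    unit_sphere x -> (forall n, unit_sphere (u n)) ->
    `|u n + x| @[n --> \oo] --> (2 : R) ->
    forall f : nat -> {linear X -> R^o}, (forall n, dual_unit_sphere (f n)) ->
      ((f n (u n) @[n --> \oo] --> (1 : R)) <->
       (f n x @[n --> \oo] --> (1 : R))).

End AlmostConvexity.

(* A linear subspace [nfs_car] of R^I endowed with a norm; the values of
   [nfs_norm] outside [nfs_car] are irrelevant. *)
Record normed_function_space (R : realType) (I : Type) := NormedFunctionSpace {
  nfs_car : set (I -> R) ;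
  nfs_norm : (I -> R) -> R ;
  nfs_mem0 : nfs_car 0 ;
  nfs_memD : forall a b, nfs_car a -> nfs_car b -> nfs_car (a + b) ;
  nfs_memZ : forall (c : R) a, nfs_car a -> nfs_car (c *: a) ;
  nfs_normD : forall a b, nfs_car a -> nfs_car b ->
    nfs_norm (a + b) <= nfs_norm a + nfs_norm b ;
  nfs_normZ : forall (c : R) a, nfs_car a ->
    nfs_norm (c *: a) = `|c| * nfs_norm a ;
  nfs_norm0_eq0 : forall a, nfs_car a -> nfs_norm a = 0 -> a = 0
}.

Section NormedFunctionSpace.
Context {R : realType} {I : Type} (E : normed_function_space R I).

Definition nfs_pred : {pred I -> R} := fun a => a \in nfs_car E.

Fact nfs_submod : submod_closed nfs_pred.
Proof.
split=> [|c a b]; first exact/mem_set/nfs_mem0.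
move=> /set_mem Ea /set_mem Eb; apply/mem_set.
by apply: nfs_memD => //; apply: nfs_memZ.
Qed.

HB.instance Definition _ :=
  GRing.isSubmodClosed.Build R (I -> R) nfs_pred nfs_submod.

Record nfs_sort := Nfs { nfs_val :> I -> R ; nfs_valP : nfs_val \in nfs_pred }.

HB.instance Definition _ := [isSub for nfs_val].
HB.instance Definition _ := [Choice of nfs_sort by <:].
HB.instance Definition _ := [SubChoice_isSubLmodule of nfs_sort by <:].

Lemma nfs_memP (a : nfs_sort) : nfs_car E a.
Proof. exact/set_mem/nfs_valP. Qed.

Fact nfs_sort_normD (a b : nfs_sort) :
  nfs_norm E (a + b : nfs_sort) <= nfs_norm E a + nfs_norm E b.
Proof. by apply: nfs_normD; apply: nfs_memP. Qed.

Fact nfs_sort_normZ (c : R) (a : nfs_sort) :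
  nfs_norm E (c *: a : nfs_sort) = `|c| * nfs_norm E a.
Proof. by apply: nfs_normZ; apply: nfs_memP. Qed.

Fact nfs_sort_norm0_eq0 (a : nfs_sort) : nfs_norm E a = 0 -> a = 0.
Proof. by move=> a0; apply/val_inj; exact: nfs_norm0_eq0 (nfs_memP a) a0. Qed.

HB.instance Definition _ := Lmodule_isNormed.Build R nfs_sort
  nfs_sort_normD nfs_sort_normZ nfs_sort_norm0_eq0.

Lemma nfs_normE (a : nfs_sort) : `|a| = nfs_norm E a. Proof. by []. Qed.

End NormedFunctionSpace.

(* The indicator [\1_[set i]] is the unit vector e_i. *)
Record absolute_space (R : realType) (I : Type) := AbsoluteSpace {
  abs_base : normed_function_space R I ;
  abs_complete : forall F : set_system (nfs_sort abs_base),
    ProperFilter F -> cauchy F -> cvg F ;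
  abs_mem_unit : forall i, nfs_car abs_base \1_[set i] ;
  abs_absolute : forall a b : I -> R, nfs_car abs_base a ->
    (forall i, `|a i| = `|b i|) ->
    nfs_car abs_base b /\ nfs_norm abs_base a = nfs_norm abs_base b ;
  abs_normalised : forall i, nfs_norm abs_base \1_[set i] = 1
}.

Definition abs_sort (R : realType) (I : Type) (E : absolute_space R I) : Type :=
  nfs_sort (abs_base E).
Coercion abs_sort : absolute_space >-> Sortclass.

HB.instance Definition _ (R : realType) (I : Type) (E : absolute_space R I) :=
  NormedModule.on (abs_sort E).
HB.instance Definition _ (R : realType) (I : Type) (E : absolute_space R I) :=
  Uniform_isComplete.Build (abs_sort E) (@abs_complete R I E).

Section AbsoluteSpace.
Context {R : realType} {I : Type} (E : absolute_space R I).

Definition unit_vector (i : I) : E := Nfs (mem_set (abs_mem_unit E i)).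

Definition unit_span : set E :=
  [set a | exists (n : nat) (c : 'I_n -> R) (i : 'I_n -> I),
     a = \sum_(k < n) c k *: unit_vector (i k)].

End AbsoluteSpace.
Arguments unit_span {R I} E _.

Section AbsoluteSpaceTheory.
Context {R : realType} {I : Type} (E : absolute_space R I).

Definition abs_mk (a : I -> R) (Ea : nfs_car (abs_base E) a) : E :=
  Nfs (mem_set Ea).

Lemma abs_coord_le (a : E) (i : I) : `|a i| <= `|a|.
Proof.
pose b (j : I) := if j \in [set i] then a j else - a j.
have ab j : `|a j| = `|b j| by rewrite /b; case: ifP; rewrite ?normrN.
have [Eb nb] := abs_absolute (nfs_memP a) ab.
have h : (2 * a i) *: unit_vector E i = a + abs_mk Eb.
  apply/val_inj/funext => j.
  rewrite /= /GRing.add /= /GRing.scale /= /b /indic.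
  case: ifPn => [/set_mem ->|_]; last by rewrite subrr; exact: mulr0.
  have -> : a i + a i = 2 * a i by ring.
  exact: mulr1.
have nu : `|unit_vector E i| = 1 by exact: abs_normalised.
have nb' : `|abs_mk Eb| = `|a| by exact/esym.
have := ler_normD a (abs_mk Eb).
rewrite -h normrZ nu mulr1 nb' normrM ger0_norm // -mulr2n -[leRHS]mulr_natl.
by rewrite ler_pM2l.
Qed.

(* [a] is the sum of the series 2^-(k+1) s_k with [`|s_k| = `|b|] pointwise;
   it converges absolutely in the complete space [E]. *)
Lemma abs_solid (a : I -> R) (b : E) : (forall i, `|a i| <= `|b i|) ->
  nfs_car (abs_base E) a /\ nfs_norm (abs_base E) a <= `|b|.
Proof.
move=> ab.
pose r := fix r k : I -> R := if k is k'.+1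
  then fun i => 2 * r k' i - (if 0 <= r k' i then `|b i| else - `|b i|) else a.
pose s k i := if 0 <= r k i then `|b i| else - `|b i|.
have rS k i : r k.+1 i = 2 * r k i - s k i by [].
have r_le k i : `|r k i| <= `|b i|.
  elim: k => [|k IH]; first exact: ab.
  move: IH; rewrite rS /s !ler_norml => /andP[l1 l2].
  by case: ifPn => [h|]; rewrite -?ltNge => *; apply/andP; split; lra.
have bs k i : `|b i| = `|s k i|.
  by rewrite /s; case: ifP; rewrite ?normrN normr_id.
have Es k := (abs_absolute (nfs_memP b) (bs k)).1.
have ns k : `|abs_mk (Es k)| = `|b|.
  exact/esym/(abs_absolute (nfs_memP b) (bs k)).2.
pose w : nat -> E := fun k => (2^-1 ^+ k.+1) *: abs_mk (Es k).
have nw k : `|w k| = geometric (`|b| / 2) 2^-1 k.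
  rewrite /w normrZ ns ger0_norm ?exprn_ge0 ?invr_ge0 //= exprS.
  by rewrite mulrC mulrA.
have wE : [normed series w] = series (geometric (`|b| / 2) 2^-1).
  by apply/funext => n; apply: eq_bigr => k _; exact: nw.
have half : `|2^-1 : R| < 1 by rewrite ger0_norm ?invr_ge0 // invf_lt1 // ltr1n.
have gcv := @cvg_geometric_series R (`|b| / 2) 2^-1 half.
have ncv : cvgn [normed series w] by rewrite wE; apply/cvg_ex; eexists; exact: gcv.
have cv : cvgn (series w) := normed_cvg ncv.
have nl : `|limn (series w)| <= `|b|.
  apply: le_trans (lim_series_norm ncv) _; rewrite wE (cvg_lim _ gcv) //.
  by rewrite le_eqVlt; apply/orP; left; apply/eqP; field.
have part n i : a i - series w n i = 2^-1 ^+ n * r n i.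
  elim: n => [|n IH].
    by rewrite /series /= big_geq // expr0 mul1r; exact: subr0.
  rewrite seriesSr.
  rewrite [X in a i - X](_ : _ = series w n i + w n i) // opprD addrA IH rS.
  rewrite [w n i](_ : _ = 2^-1 ^+ n.+1 * s n i) // exprS.
  by field.
suff -> : a = limn (series w) by split; [exact: nfs_memP | exact: nl].
apply/funext => i.
apply: (@cvg_unique _ _ (series w n i @[n --> \oo])) => //.
- apply/cvgrPdist_lt => e e0.
  have : 2^-1 ^+ n * `|b i| @[n --> \oo] --> (0 : R).
    by rewrite -[X in _ --> X](mul0r `|b i|); apply: cvgMr_tmp; exact: cvg_expr.
  move=> /cvgrPdist_lt /(_ e e0); apply: filterS => n.
  rewrite part sub0r normrN; apply: le_lt_trans.
  by rewrite !normrM ler_wpM2l // normr_id.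
- apply/cvgrPdist_lt => e e0.
  have /cvgrPdist_lt /(_ e e0) := cv.
  apply: filterS => n; apply: le_lt_trans.
  exact: (abs_coord_le (limn (series w) - series w n) i).
Qed.

End AbsoluteSpaceTheory.

Section AbsoluteSum.
Context {R : realType} {I : Type} (E : absolute_space R I).
Variable X : I -> completeNormedModType R.

Record absolute_sum := AbsoluteSum {
  asum_val :> forall i, X i ;
  asum_memP : nfs_car (abs_base E) (fun i => `|asum_val i|)
}.

HB.instance Definition _ := gen_eqMixin absolute_sum.
HB.instance Definition _ := gen_choiceMixin absolute_sum.

Lemma asum_ext (x y : absolute_sum) : (forall i, x i = y i) -> x = y.
Proof.
case: x y => [x hx] [y hy] /= xy.
have {}xy : x = y by exact: functional_extensionality_dep.
by subst y; rewrite (Prop_irrelevance hx hy).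
Qed.

Fact asum_mem0 : nfs_car (abs_base E) (fun i => `|0 : X i|).
Proof. by under eq_fun do rewrite normr0; exact: nfs_mem0. Qed.

Fact asum_memD (x y : absolute_sum) :
  nfs_car (abs_base E) (fun i => `|x i + y i|).
Proof.
pose b := abs_mk (asum_memP x) + abs_mk (asum_memP y).
have /(_ (fun i => `|x i + y i|)) [i|//] := abs_solid (b := b).
rewrite [b i](_ : _ = `|x i| + `|y i|) // normr_id.
by rewrite (le_trans (ler_normD _ _)) // ler_norm.
Qed.

Fact asum_memN (x : absolute_sum) : nfs_car (abs_base E) (fun i => `|- x i|).
Proof. by under eq_fun do rewrite normrN; exact: asum_memP. Qed.

Fact asum_memZ (c : R) (x : absolute_sum) :
  nfs_car (abs_base E) (fun i => `|c *: x i|).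
Proof.
by under eq_fun do rewrite normrZ; exact: nfs_memZ (asum_memP x).
Qed.

Definition asum0 := AbsoluteSum asum_mem0.
Definition asum_add x y := AbsoluteSum (asum_memD x y).
Definition asum_opp x := AbsoluteSum (asum_memN x).
Definition asum_scale c x := AbsoluteSum (asum_memZ c x).

Fact asum_addA : associative asum_add.
Proof. by move=> x y z; apply: asum_ext => i; exact: addrA. Qed.
Fact asum_addC : commutative asum_add.
Proof. by move=> x y; apply: asum_ext => i; exact: addrC. Qed.
Fact asum_add0 : left_id asum0 asum_add.
Proof. by move=> x; apply: asum_ext => i; exact: add0r. Qed.
Fact asum_addN : left_inverse asum0 asum_opp asum_add.
Proof. by move=> x; apply: asum_ext => i; exact: addNr. Qed.

HB.instance Definition _ :=
  GRing.isZmodule.Build absolute_sum asum_addA asum_addC asum_add0 asum_addN.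

Fact asum_scaleA a b (x : absolute_sum) :
  asum_scale a (asum_scale b x) = asum_scale (a * b) x.
Proof. by apply: asum_ext => i; exact: scalerA. Qed.
Fact asum_scale1 : left_id 1 asum_scale.
Proof. by move=> x; apply: asum_ext => i; exact: scale1r. Qed.
Fact asum_scaleDr : right_distributive asum_scale +%R.
Proof. by move=> c x y; apply: asum_ext => i; exact: scalerDr. Qed.
Fact asum_scaleDl (x : absolute_sum) : {morph asum_scale^~ x : a b / a + b}.
Proof. by move=> a b; apply: asum_ext => i; exact: scalerDl. Qed.

HB.instance Definition _ := GRing.Zmodule_isLmodule.Build R absolute_sum
  asum_scaleA asum_scale1 asum_scaleDr asum_scaleDl.

Definition asum_norm (x : absolute_sum) : R :=
  nfs_norm (abs_base E) (fun i => `|x i|).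

Fact asum_normD (x y : absolute_sum) :
  asum_norm (x + y) <= asum_norm x + asum_norm y.
Proof.
pose a := abs_mk (asum_memP x); pose b := abs_mk (asum_memP y).
apply: le_trans (ler_normD a b).
apply: (abs_solid (b := a + b) _).2 => i.
rewrite [(a + b) i](_ : _ = `|x i| + `|y i|) // normr_id.
exact: le_trans (ler_normD _ _) (ler_norm _).
Qed.

Fact asum_normZ (c : R) (x : absolute_sum) :
  asum_norm (c *: x) = `|c| * asum_norm x.
Proof.
rewrite /asum_norm; under eq_fun do rewrite [(c *: x) _]/(c *: x _) normrZ.
by rewrite -[`|c| in RHS]normr_id; exact: nfs_normZ (asum_memP x).
Qed.

Fact asum_norm0_eq0 (x : absolute_sum) : asum_norm x = 0 -> x = 0.
Proof.
move=> /(nfs_norm0_eq0 (asum_memP x)) x0; apply: asum_ext => i.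
by apply/normr0_eq0; exact: (congr1 (fun a => a i) x0).
Qed.

HB.instance Definition _ := Lmodule_isNormed.Build R absolute_sum
  asum_normD asum_normZ asum_norm0_eq0.

Lemma asum_normE (x : absolute_sum) :
  `|x| = nfs_norm (abs_base E) (fun i => `|x i|).
Proof. by []. Qed.

Let asum_abs (x : absolute_sum) : E := abs_mk (asum_memP x).

Let asum_abs_norm x : `|asum_abs x| = `|x|. Proof. by []. Qed.

Lemma asum_coord_le (x : absolute_sum) i : `|x i| <= `|x|.
Proof.
rewrite -asum_abs_norm -[leLHS]normr_id; exact: (abs_coord_le (asum_abs x) i).
Qed.

Let asum_abs_dist x y : `|asum_abs x - asum_abs y| <= `|x - y|.
Proof.
rewrite -(asum_abs_norm (x - y)).
apply: (abs_solid (a := asum_abs x - asum_abs y) _).2 => i.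
rewrite [(asum_abs x - asum_abs y) i](_ : _ = `|x i| - `|y i|) //.
by rewrite /= normr_id; exact: ler_dist_dist.
Qed.

Fact asum_complete (F : set_system absolute_sum) :
  ProperFilter F -> cauchy F -> cvg F.
Proof.
move=> FF /cauchyP Fc.
have Fc' (e : R) : 0 < e -> exists x0, \forall x \near F, `|x0 - x| < e.
  by move=> /Fc [x0 h]; exists x0; move: h; rewrite -ball_normE.
have cvi i : cvg ((fun x : absolute_sum => x i) @ F).
  apply/cauchy_cvgP/cauchyP => e /Fc' [x0 h]; exists (x0 i).
  rewrite -ball_normE /=; apply: filterS h => x; apply: le_lt_trans.
  exact: (asum_coord_le (x0 - x) i).
pose l i : X i := lim ((fun x : absolute_sum => x i) @ F).
have cvl i : (fun x : absolute_sum => x i) @ F --> l i by exact: cvi.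
have cva (y : absolute_sum) : cvg ((fun x => asum_abs (x - y)) @ F).
  apply/cauchy_cvgP/cauchyP => e /Fc' [x0 h]; exists (asum_abs (x0 - y)).
  rewrite -ball_normE /=; apply: filterS h => x; apply: le_lt_trans.
  by apply: le_trans (asum_abs_dist _ _) _; rewrite opprB addrA subrK.
pose g y : E := lim ((fun x => asum_abs (x - y)) @ F).
have cvg_g y : (fun x => asum_abs (x - y)) @ F --> g y by exact: cva.
have gE y i : g y i = `|l i - y i|.
  apply: (@cvg_unique _ _ ((fun x : absolute_sum => `|x i - y i|) @ F)) => //.
    apply/cvgrPdist_lt => e e0; move/cvgrPdist_lt: (cvg_g y) => /(_ e e0).
    apply: filterS => x; apply: le_lt_trans.
    exact: (abs_coord_le (g y - asum_abs (x - y)) i).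
  by apply: cvg_norm; apply: cvgB; [exact: cvl|exact: cvg_cst].
have lE : nfs_car (abs_base E) (fun i => `|l i|).
  suff -> : (fun i => `|l i|) = nfs_val (g 0) by exact: nfs_memP.
  apply/funext => i; rewrite gE; congr `|_|; exact/esym/subr0.
pose L := AbsoluteSum lE.
apply/cvg_ex; exists L; apply/fcvgrPdist_lt => e e0.
have e20 : 0 < e / 2 by rewrite divr_gt0.
have [x0 h] := Fc' _ e20.
have Lx0 : `|L - x0| <= e / 2.
  rewrite -asum_abs_norm.
  have -> : asum_abs (L - x0) = g x0 by apply/val_inj/funext => i /=; rewrite gE.
  apply/ler_addgt0Pr => d d0.
  have hd : \forall x \near F, `|g x0 - asum_abs (x - x0)| < d.
    by move/cvgrPdist_lt: (cvg_g x0); exact.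
  have [x [hx hx']] := filter_ex (filterI h hd).
  rewrite -[g x0](subrK (asum_abs (x - x0))) addrC.
  apply: le_trans (ler_normD _ _) _; apply: lerD; last exact: ltW.
  by rewrite asum_abs_norm distrC ltW.
apply: filterS h => x hx.
rewrite -(subrK x0 L) -addrA [e]splitr.
by apply: le_lt_trans (ler_normD _ _) _; exact: ler_ltD.
Qed.

HB.instance Definition _ :=
  Uniform_isComplete.Build absolute_sum asum_complete.

End AbsoluteSum.

(* Main.v *)
Require Import Defs.
From HB Require Import structures.
From mathcomp Require Import all_boot all_order all_algebra.
From mathcomp Require Import all_classical all_reals all_analysis.
From mathcomp Require Import ring lra.

Set Implicit Arguments.
Unset Strict Implicit.
Unset Printing Implicit Defensive.

Import Order.TTheory GRing.Theory Num.Theory.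
Import numFieldNormedType.Exports.

Local Open Scope classical_set_scope.
Local Open Scope ring_scope.

(** Write [Z] for the sum, [f_i] for the restriction of a functional [f] on [Z]
to the [i]-th summand and [|u|] for the element [(`|u i|)_i] of [E].

Both properties are cases of one epsilon-delta statement, [uniform_acs K],
about families of functionals of norm at most 1 indexed by a type [K]: the
threshold delta may depend on the family and on the point [x], but not on the
index. The one-element family gives the property luacs, and sequences give
sluacs. So it suffices that [uniform_acs K] passes from [E] and the summands
to the sum ([sum_uniform_acs]).

Let [u] and [x] be in the unit ball of [Z] with [`|u + x|] close to 2 and
[f u] close to 1. A functional [f] of norm at most 1 on [Z] induces the
functional [g] on [E] that maps [a >= 0] to the supremum of [f z] over the [z]
with [`|z i| <= a i] for all [i] ([dominating_functional]). Now
[`| |u| + |x| | >= `|u + x|] and [g |u| >= f u], so the property of [E] makes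
[g |x|] close to 1. This says that some [z], pointwise not larger than [x],
has [f z] close to 1. As the finitely supported families are dense in [E], the
difference [f z - f x] is controlled by finitely many of the numbers
[f_i (z i) - f_i (x i)], and it remains to see that each of them is almost
nonpositive, that is, that [f_i] almost attains at [x i] its supremum over the
ball of radius [`|x i|] ([coordinate_norming]).

Fix [i]. There is something to prove only if [f_i] is not small on that ball.
- If [`|u i|] is small, then [f] with its [i]-th coordinate erased is still
  close to 1 at [u]; by the property of [E] it is almost norming on the
  families dominated by [|x|], which leaves almost nothing for [f_i]
  ([small_coordinate]).
- If [`|u i + x i| <= `|u i| + `|x i| - r], then lowering the [i]-th coordinate
  of [|x|] by [r] yields [a] with [`| |u| + a | >= `|u + x|]. The property of
  [E] at [a] shows that [f] is almost norming on the families dominated by [a],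
  and again almost nothing is left for [f_i] ([nonaligned_coordinate]).
- Otherwise the normalizations of [u i] and [x i] have a sum of norm close to 2.
  Moreover [f_i] almost attains at [u i] its supremum over the ball of radius
  [`|u i|], since replacing the [i]-th coordinate of [u] cannot increase [f u]
  beyond 1. The property of the summand [X i] then gives the claim. *)

(** * Functionals of norm at most 1 *)

Section NormedSpace.
Context {R : realType}.
Implicit Type X : normedModType R.

Definition contractive X (f : {linear X -> R^o}) := forall x, f x <= `|x|.

Lemma linear_functional_exists X (f : X -> R^o) : linear f ->
  exists g : {linear X -> R^o}, forall x, g x = f x.
Proof.
move=> fl.
pose g : {linear X -> R^o} :=
  HB.pack f (GRing.isLinear.Build R X R^o *:%R f fl).
by exists g.
Qed.

Lemma contractive_norm X (f : {linear X -> R^o}) : contractive f ->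
  forall x, `|f x| <= `|x|.
Proof. by move=> fc x; rewrite ler_norml lerNl -linearN -{1}normrN !fc. Qed.

Lemma contractive_continuous X (f : {linear X -> R^o}) :
  contractive f -> continuous f.
Proof.
move=> /contractive_norm fc; apply: bounded_linear_continuous.
exists 1; split; first exact: num_real.
move=> M M1; apply/nbhs_ballP; exists 1 => //= x;
  rewrite -ball_normE /= sub0r normrN => x1.
by rewrite (le_trans (fc x)) // (le_trans (ltW x1)) // ltW.
Qed.

Lemma contractive_has_sup X (f : {linear X -> R^o}) : contractive f ->
  has_sup [set `|f x| | x in [set x : X | `|x| <= 1]].
Proof.
move=> /contractive_norm fc; split.
  by exists `|f 0|; exists 0 => //=; rewrite normr0.
by exists 1 => _ [x /= x1 <-]; exact: le_trans (fc x) x1.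
Qed.

Lemma dual_norm_le1 X (f : {linear X -> R^o}) :
  contractive f -> dual_norm f <= 1.
Proof.
move=> fc; have [ne _] := contractive_has_sup fc;
  apply: ge_sup => // _ [x /= x1 <-].
exact: le_trans (contractive_norm fc x) x1.
Qed.

Lemma ler_dual_norm X (f : {linear X -> R^o}) :
  has_sup [set `|f x| | x in [set x : X | `|x| <= 1]] ->
  forall x, f x <= dual_norm f * `|x|.
Proof.
move=> [_ ub] x; have [->|x0] := eqVneq x 0.
  by rewrite linear0 normr0 mulr0.
have nx : 0 < `|x| by rewrite normr_gt0.
apply: le_trans (ler_norm _) _; rewrite -ler_pdivrMr //.
apply: (ub_le_sup ub); exists (`|x|^-1 *: x) => /=.
  by rewrite normrZ normfV normr_id mulVf ?gt_eqF.
by rewrite linearZ /= /GRing.scale /= normrM normfV normr_id mulrC.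
Qed.

Lemma dual_norm_ge0 X (f : {linear X -> R^o}) :
  contractive f -> 0 <= dual_norm f.
Proof.
move=> /contractive_has_sup[_ ub]; apply: le_trans (normr_ge0 (f 0)) _.
by apply: (ub_le_sup ub); exists 0 => //=; rewrite normr0.
Qed.

Lemma dual_norm_ler X (f : {linear X -> R^o}) (r c : R) :
  contractive f -> 0 < r ->
  (forall x, `|x| <= r -> f x <= c) -> dual_norm f * r <= c.
Proof.
move=> fc r0 h; rewrite -ler_pdivlMr //; apply: ge_sup.
  exact: (contractive_has_sup fc).1.
move=> _ [x /= x1 <-]; rewrite ler_pdivlMr // mulrC -{1}(gtr0_norm r0) -normrM.
have rx y : `|y| = `|x| -> r * f y <= c.
  move=> yx; have := h (r *: y); rewrite linearZ /= /GRing.scale /=; apply.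
  by rewrite normrZ yx gtr0_norm // ger_pMr.
by rewrite ler_norml lerNl -mulrN -linearN !rx // normrN.
Qed.

(** A supremum over an unbounded set is 0 by convention, so dual norm 1 forces
the set of values on the unit ball to be bounded. *)
Lemma dual_unit_sphere_contractive X (f : {linear X -> R^o}) :
  dual_unit_sphere f -> contractive f.
Proof.
move=> [_ f1] x; rewrite -[leRHS]mul1r -f1; apply: ler_dual_norm.
apply: contrapT => /sup_out f0; move: f1; rewrite /dual_norm f0 => /esym/eqP.
by rewrite oner_eq0.
Qed.

(** The first two conclusions include the case [dual_norm f = 0], in which [g]
is 0 because of the convention [0^-1 = 0]. *)
Lemma dual_norm_normalize X (f : {linear X -> R^o}) : contractive f ->
  exists g : {linear X -> R^o},
    [/\ contractive g, forall x, g x = (dual_norm f)^-1 * f x &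
        0 < dual_norm f -> dual_unit_sphere g].
Proof.
move=> fc.
have [g gE] : exists g : {linear X -> R^o},
    forall x, g x = (dual_norm f)^-1 * f x.
  apply: linear_functional_exists => a x y.
  by rewrite linearP mulrDr /GRing.scale /= !mulrA (mulrC a).
have gc : contractive g.
  move=> x; rewrite gE; have := dual_norm_ge0 fc;
    rewrite le_eqVlt => /orP[/eqP<-|b0].
    by rewrite invr0 mul0r.
  by rewrite ler_pdivrMl //; apply/ler_dual_norm/contractive_has_sup.
exists g; split => // b0; split; first exact: contractive_continuous.
apply/eqP; rewrite eq_le dual_norm_le1 //= -(ler_pM2l b0) mulr1.
rewrite -[leLHS]mulr1; apply: dual_norm_ler => // x x1.
rewrite -[f x](mulVKf (lt0r_neq0 b0)) -gE ler_pM2l //.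
apply: le_trans (ler_dual_norm (contractive_has_sup gc) x) _.
by rewrite ler_piMr //; exact: dual_norm_ge0.
Qed.

(** If [`|y| <= `|x|], then [x + y] is [`|y|] times the sum of the two unit
vectors plus a vector of norm [`|x| - `|y|]. So the defect of [x], [y] in the
triangle inequality is at least [`|y|] times the defect of the unit vectors. *)
Lemma normalized_sum_ge X (x y : X) (c : R) : 0 < c -> c <= `|x| -> c <= `|y| ->
  2 - (`|x| + `|y| - `|x + y|) / c <= `| `|x|^-1 *: x + `|y|^-1 *: y|.
Proof.
wlog yx : x y / `|y| <= `|x|.
  move=> h c0 cx cy; have [yx|/ltW xy] := leP `|y| `|x|; first exact: h.
  by rewrite (addrC `|x|) (addrC x) (addrC (_ *: x)); exact: h.
move=> c0 cx cy.
have x0 : 0 < `|x| by exact: lt_le_trans cx.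
have y0 : 0 < `|y| by exact: lt_le_trans cy.
set s := `|x|^-1 *: x + _.
have s2 : `|s| <= 2.
  apply: le_trans (ler_normD _ _) _; rewrite !normrZ !normfV !normr_id.
  by rewrite !mulVf ?gt_eqF.
have xyE : x + y = `|y| *: s + (`|x| - `|y|) *: (`|x|^-1 *: x).
  rewrite /s scalerDr (scalerA _ _ y) mulfV ?gt_eqF // scale1r addrAC -scalerDl.
  by rewrite (addrC `|y|) subrK scalerA mulfV ?gt_eqF // scale1r.
have : `|x + y| <= `|y| * `|s| + (`|x| - `|y|).
  rewrite xyE; apply: le_trans (ler_normD _ _) _; rewrite !normrZ normr_id.
  rewrite lerD2l normfV normr_id mulVf ?gt_eqF // mulr1 ger0_norm ?subr_ge0 //.
move=> h; rewrite lerBlDr -lerBlDl ler_pdivlMr //.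
apply: (@le_trans _ _ ((2 - `|s|) * `|y|));
  first by rewrite ler_wpM2l // subr_ge0.
lra.
Qed.

End NormedSpace.

(** * An epsilon-delta form of both properties *)

Section Uniform.
Context {R : realType}.
Implicit Type X : completeNormedModType R.

(** Vectors and functionals of norm at most 1 are allowed, instead of norm
exactly 1, so that erasing or lowering coordinates needs no renormalization. *)
Definition uniform_acs (K : Type) X : Prop :=
  forall f : K -> {linear X -> R^o}, (forall k, contractive (f k)) ->
  forall x : X, `|x| <= 1 -> forall e : R, 0 < e ->
  exists2 d : R, 0 < d & forall k u, `|u| <= 1 ->
    2 - d < `|u + x| -> 1 - d < f k u -> 1 - e < f k x.

Lemma cvg_harmonic_minorant (a : nat -> R) (l : R) :
  (forall n, l - harmonic n <= a n <= l) -> a n @[n --> \oo] --> l.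
Proof.
move=> h; apply: (@squeeze_cvgr _ _ _ _ (fun n => l - harmonic n) (fun=> l)).
- by near=> n; exact: h.
- rewrite -[X in _ --> X]subr0.
  by apply: cvgB; [exact: cvg_cst | exact: cvg_harmonic].
- exact: cvg_cst.
Unshelve. all: by end_near. Qed.

(** If no [d] works, then the choices [d = harmonic n / 2] give sequences along
which the norms and values converge; the vectors can be made unit vectors because
their norms, being at least [f u], tend to 1. *)
Lemma acs_counterexample K X (f : K -> {linear X -> R^o}) (x : X) (e : R) :
  (forall k, contractive (f k)) -> `|x| <= 1 -> 0 < e ->
  (forall d, 0 < d -> exists k u, [/\ `|u| <= 1, 2 - d < `|u + x|,
     1 - d < f k u & f k x <= 1 - e]) ->
  unit_sphere x /\ exists (u : nat -> X) (k : nat -> K),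
    [/\ forall n, unit_sphere (u n), `|u n + x| @[n --> \oo] --> (2 : R),
        f (k n) (u n) @[n --> \oo] --> (1 : R),
        dual_norm (f (k n)) @[n --> \oo] --> (1 : R) &
        forall n, 0 < dual_norm (f (k n)) /\ f (k n) x <= 1 - e].
Proof.
move=> fc x1 e0 h; split.
  apply/eqP; rewrite /= eq_le x1 /= leNgt; apply/negP => x_lt1.
  have /h[k [u [u1 ux _ _]]] : 0 < 1 - `|x| by rewrite subr_gt0.
  have := ler_normD u x; lra.
have h0 n : 0 < @harmonic R n by exact: harmonic_gt0.
have h1 n : @harmonic R n <= 1 by rewrite /= invf_le1 // ler1n.
have d0 n : 0 < @harmonic R n / 2 by rewrite divr_gt0.
have /choice[ku kuP] : forall n, exists p : K * X, [/\ `|p.2| <= 1,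
    2 - harmonic n / 2 < `|p.2 + x|, 1 - harmonic n / 2 < f p.1 p.2 &
    f p.1 x <= 1 - e].
  by move=> n; have [k [u P]] := h _ (d0 n); exists (k, u).
pose u n := (ku n).2; pose k n := (ku n).1.
have u0 n : 0 < `|u n|.
  have [_ _ fu _] := kuP n; apply: (lt_le_trans _ (fc (k n) _)).
  rewrite /k /u; have := h1 n; have := fu; lra.
have uu n : `| `|u n|^-1 *: u n| = 1.
  by rewrite normrZ normfV normr_id mulVf ?gt_eqF.
have fu n : 1 - harmonic n / 2 < f (k n) (u n) by have [] := kuP n.
have fu' n : 1 - harmonic n / 2 < f (k n) (`|u n|^-1 *: u n).
  apply: (lt_le_trans (fu n)); rewrite linearZ /= /GRing.scale /=.
  rewrite ler_peMl //; first by have := fu n; have := h1 n; lra.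
  by rewrite invf_ge1 //; have [] := kuP n.
have bn n : 1 - harmonic n / 2 < dual_norm (f (k n)).
  apply: (lt_le_trans (fu' n)); rewrite -[leRHS]mulr1 -(uu n).
  exact/ler_dual_norm/contractive_has_sup.
exists (fun n => `|u n|^-1 *: u n), k; split => //.
- apply: cvg_harmonic_minorant => n; apply/andP; split; last first.
    by apply: le_trans (ler_normD _ _) _; rewrite uu; lra.
  have [_ ux _ _] := kuP n.
  have := ler_normD (`|u n|^-1 *: u n + x) (u n - `|u n|^-1 *: u n).
  rewrite [X in `|X|](_ : _ = u n + x); last by rewrite addrC addrA subrK.
  suff : `|u n - `|u n|^-1 *: u n| <= harmonic n / 2.
    by move: ux; rewrite -/(u n); lra.
  rewrite -{1}[u n]scale1r -scalerBl normrZ -[X in _ * X]ger0_norm //.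
  rewrite -normrM mulrBl mul1r.
  rewrite mulVf ?gt_eqF // distrC ger0_norm; last by rewrite subr_ge0;
    have [] := kuP n.
  have := fc (k n) (u n); have := fu n; lra.
- apply: cvg_harmonic_minorant => n; apply/andP; split.
    by have := fu' n; have := h0 n; lra.
  by rewrite -(uu n); exact: fc.
- apply: cvg_harmonic_minorant => n; apply/andP; split.
    by have := bn n; have := h0 n; lra.
  exact: dual_norm_le1.
- move=> n; split; last by have [] := kuP n.
  by have := bn n; have := h1 n; lra.
Qed.

Lemma not_uniform_acs K X : ~ uniform_acs K X ->
  exists (f : K -> {linear X -> R^o}) (x : X) (e : R),
    [/\ forall k, contractive (f k), `|x| <= 1, 0 < e &
      forall d, 0 < d -> exists k u, [/\ `|u| <= 1, 2 - d < `|u + x|,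
     1 - d < f k u & f k x <= 1 - e]].
Proof.
move=> h; apply: contrapT => nh; apply: h => f fc x x1 e e0.
apply: contrapT => nd; apply: nh; exists f, x, e; split => // d d0.
apply: contrapT => nk; apply: nd; exists d => // k u u1 ux fu.
by rewrite ltNge; apply/negP => fx; apply: nk; exists k, u.
Qed.

(** The constant sequence [dual_norm (f tt)] converges to 1 along a
counterexample, so [f tt] itself lies on the dual sphere. *)
Lemma luacs_uniform_acs X : luacs X -> uniform_acs unit X.
Proof.
move=> hX; apply: contrapT => /not_uniform_acs[f [x [e [fc x1 e0 h]]]].
have [sx [u [k [su ux fu bn fx]]]] := acs_counterexample fc x1 e0 h.
have kE : k = (fun=> tt) by apply/funext => n; case: (k n).
rewrite {}kE in fu bn fx.
have fs : dual_unit_sphere (f tt).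
  split; first exact: contractive_continuous.
  by apply: (@cvg_unique _ _ (dual_norm (f tt) @[n --> \oo])) => //;
    exact: cvg_cst.
have fx1 : f tt x = 1 by exact: (hX x u).
by have [_] := fx 0; rewrite fx1 lerBrDr gerDl leNgt e0.
Qed.

(** Along a counterexample the dual norms tend to 1, so the functionals can be
normalized without changing any limit. *)
Lemma sluacs_uniform_acs K X : sluacs X -> uniform_acs K X.
Proof.
move=> hX; apply: contrapT => /not_uniform_acs[f [x [e [fc x1 e0 h]]]].
have [sx [u [k [su ux fu bn fx]]]] := acs_counterexample fc x1 e0 h.
have /choice[g gP] n := dual_norm_normalize (fc (k n)).
have gs n : dual_unit_sphere (g n) by have [_ _] := gP n; apply;
  have [] := fx n.
have gE y n : g n y = (dual_norm (f (k n)))^-1 * f (k n) y by have [] := gP n.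
have bV : (dual_norm (f (k n)))^-1 @[n --> \oo] --> (1 : R).
  by have := cvgV (oner_neq0 _) bn; rewrite invr1; apply.
have gx : g n x @[n --> \oo] --> (1 : R).
  apply: (hX x u) => //.
  have -> : (1 : R) = 1 * 1 by rewrite mulr1.
  by under eq_fun do rewrite gE; apply: cvgM bV fu.
have fx1 : f (k n) x @[n --> \oo] --> (1 : R).
  have -> : (fun n => f (k n) x) = (fun n => dual_norm (f (k n)) * g n x).
    by apply/funext => n; rewrite gE mulVKf // gt_eqF //; have [] := fx n.
  have -> : (1 : R) = 1 * 1 by rewrite mulr1.
  exact: cvgM bn gx.
have : (1 : R) <= 1 - e.
  by apply: (cvgr_to_le fx1); near=> n; have [] := fx n.
lra.
Unshelve. all: by end_near. Qed.

Lemma uniform_acs_sluacs X : uniform_acs nat X -> sluacs X.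
Proof.
move=> hX x u f sx su sf ux fu.
have fc n := dual_unit_sphere_contractive (sf n).
have x1 : `|x| <= 1 by rewrite sx.
apply/cvgrPdist_lt => e e0; have [d d0 hd] := hX f fc x x1 e e0.
move/cvgrPdist_lt: ux => /(_ _ d0); move/cvgrPdist_lt: fu => /(_ _ d0).
apply: filterS2 => n fu ux.
have fx : 1 - e < f n x.
  apply: (hd n (u n)); first by rewrite su.
    by move: ux; rewrite ltr_norml; lra.
  by move: fu; rewrite ltr_norml; lra.
by have := fc n x; rewrite sx ltr_norml; lra.
Qed.

Lemma uniform_acs_luacs X : uniform_acs unit X -> luacs X.
Proof.
move=> hX x u f sx su sf ux fu.
have fc := dual_unit_sphere_contractive sf.
have x1 : `|x| <= 1 by rewrite sx.
apply/eqP; rewrite eq_le -{1}sx fc /=; apply/ler_addgt0Pr => e e0.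
have [d d0 hd] := hX (fun=> f) (fun=> fc) x x1 e e0.
move/cvgrPdist_lt: ux => /(_ _ d0); move/cvgrPdist_lt: fu => /(_ _ d0) fu ux.
have [n [{}fu {}ux]] := filter_ex (filterI fu ux).
suff : 1 - e < f x by lra.
apply: (hd tt (u n)); first by rewrite su.
  by move: ux; rewrite ltr_norml; lra.
by move: fu; rewrite ltr_norml; lra.
Qed.

End Uniform.

(** * Coordinates in an absolute sum *)

Section Sum.
Context {R : realType} {I : Type} (E : absolute_space R I).
Variable X : I -> completeNormedModType R.
Local Notation Z := (absolute_sum E X).

Lemma abs_norm_le (a b : E) : (forall i, `|a i| <= `|b i|) -> `|a| <= `|b|.
Proof. by move=> ab; exact: (abs_solid ab).2. Qed.

Lemma abs_fun (a : I -> R) (b : E) : (forall i, `|a i| <= `|b i|) ->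
  exists c : E, forall i, c i = a i.
Proof. by move=> ab; exists (abs_mk (abs_solid ab).1). Qed.

Definition pointwise_norm (z : Z) : E := abs_mk (asum_memP z).

Lemma asum_norm_le (z : Z) (a : E) :
  (forall i, `|z i| <= `|a i|) -> `|z| <= `|a|.
Proof. by move=> za; apply: (@abs_norm_le (pointwise_norm z)) => i /=;
  rewrite normr_id. Qed.

Lemma asum_fun (z : forall i, X i) (a : E) : (forall i, `|z i| <= `|a i|) ->
  exists z' : Z, forall i, z' i = z i.
Proof.
move=> za; have za' i : `| `|z i| | <= `|a i| by rewrite normr_id.
by exists (AbsoluteSum (abs_solid za').1).
Qed.

(** The index type has no decidable equality, hence the classical case
distinction and the transport of [w] along [i = j]. *)
Definition single_fun (i : I) (w : X i) : forall j, X j := fun j =>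
  if pselect (i = j) is left e then eq_rect i X w j e else 0.

Lemma single_fun_eq i (w : X i) : single_fun w i = w.
Proof.
rewrite /single_fun; case: pselect => // e.
by rewrite (Prop_irrelevance e erefl).
Qed.

Lemma single_fun_neq i j (w : X i) : i <> j -> single_fun w j = 0.
Proof. by rewrite /single_fun; case: pselect. Qed.

Fact single_mem i (w : X i) : nfs_car (abs_base E) (fun j => `|single_fun w j|).
Proof.
suff -> : (fun j => `|single_fun w j|) = `|w| *: \1_[set i].
  exact: nfs_memZ (abs_mem_unit E i).
apply/funext => j; rewrite /= /GRing.scale /= /indic.
have [<-|ij] := pselect (i = j).
  by rewrite single_fun_eq mem_set //= /GRing.scale /= mulr1.
rewrite single_fun_neq // memNset /= ?normr0 ?/GRing.scale /= ?mulr0 //.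
by move=> /esym.
Qed.

Definition single i (w : X i) : Z := AbsoluteSum (single_mem w).

Lemma single_eq i (w : X i) : single w i = w.
Proof. exact: single_fun_eq. Qed.

Lemma single_neq i j (w : X i) : i <> j -> single w j = 0.
Proof. exact: single_fun_neq. Qed.

Lemma single_linear i : linear (@single i).
Proof.
move=> c v w; apply: asum_ext => j.
rewrite [RHS](_ : _ = c *: single v j + single w j) //.
have [<-|ij] := pselect (i = j); first by rewrite !single_eq.
by rewrite !single_neq // scaler0 addr0.
Qed.

HB.instance Definition _ i :=
  GRing.isLinear.Build R (X i) Z *:%R (@single i) (@single_linear i).

Lemma norm_single i (w : X i) : `|single w| <= `|w|.
Proof.
have -> : `|w| = `| `|w| *: unit_vector E i|.
  by rewrite normrZ normr_id [`|unit_vector E i|]abs_normalised mulr1.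
apply: asum_norm_le => j.
have [<-|ij] := pselect (i = j); last by rewrite single_neq // normr0.
rewrite single_eq [(_ *: _ : E) i](_ : _ = `|w| * \1_[set i] i) //.
by rewrite /indic mem_set //= mulr1 normr_id.
Qed.

Lemma contractive_single (f : {linear Z -> R^o}) i : contractive f ->
  exists g : {linear X i -> R^o}, contractive g /\ forall w, g w = f (single w).
Proof.
move=> fc;
  have [g gE] : exists g : {linear X i -> R^o}, forall w, g w = f (single w).
  by apply: linear_functional_exists => c v w; rewrite !linearP.
by exists g; split=> // w; rewrite gE (le_trans (fc _)) // norm_single.
Qed.

Definition erase i (z : Z) : Z := z - single (z i).

Lemma erase_eq i z : erase i z i = 0.
Proof.
by rewrite [erase i z i](_ : _ = z i - single (z i) i) // single_eq subrr.
Qed.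

Lemma erase_neq i j z : i <> j -> erase i z j = z j.
Proof.
move=> ij.
by rewrite [erase i z j](_ : _ = z j - single (z i) j) // single_neq // subr0.
Qed.

Lemma contractive_erase (f : {linear Z -> R^o}) i : contractive f ->
  exists g : {linear Z -> R^o}, contractive g /\ forall z, g z = f (erase i z).
Proof.
move=> fc;
  have [g gE] : exists g : {linear Z -> R^o}, forall z, g z = f (erase i z).
  apply: linear_functional_exists => c v w; rewrite -linearP; congr (f _);
    rewrite /erase.
  rewrite [(c *: v + w) i](_ : _ = c *: v i + w i) // [single _]linearP.
  by rewrite scalerBr opprD addrACA.
exists g; split=> // z; rewrite gE (le_trans (fc _)) //.
apply: (@asum_norm_le _ (pointwise_norm z)) => j; rewrite [leRHS]normr_id.
have [<-|ij] := pselect (i = j); first by rewrite erase_eq normr0.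
by rewrite erase_neq.
Qed.

Lemma norm_pointwiseD (u x : Z) :
  `|u + x| <= `|pointwise_norm u + pointwise_norm x|.
Proof.
apply: asum_norm_le => i.
rewrite [(u + x) i](_ : _ = u i + x i) //.
rewrite [(pointwise_norm u + pointwise_norm x) i](_ : _ = `|u i| + `|x i|) //.
by rewrite (le_trans (ler_normD _ _)) // ler_norm.
Qed.

(** Coordinates can be erased one after the other, each at a cost of at most
[c]. The list may contain repetitions: a coordinate that is erased twice is 0
the second time, which is why [0 <= c] is assumed. *)
Lemma finite_coordinates (g : {linear Z -> R^o}) (s : seq I) (v : Z) (c : R) :
  0 <= c -> (forall i, List.In i s -> g (single (v i)) <= c) ->
  exists v' : Z, g v <= (size s)%:R * c + g v' /\
    forall j, v' j = 0 \/ (v' j = v j /\ ~ List.In j s).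
Proof.
move=> c0; elim: s => [|i s IH] gs.
  by exists v; rewrite mul0r add0r; split=> // j; right; split.
have [|v' [gv' v'P]] := IH; first by move=> j js; apply: gs; right.
exists (erase i v'); split.
  have : g (single (v' i)) <= c.
    have [->|[-> _]] := v'P i; last by apply: gs; left.
    by rewrite !linear0.
  by rewrite /erase linearB /= -natr1 mulrDl mul1r; lra.
move=> j; have [<-|ij] := pselect (i = j); first by left; rewrite erase_eq.
rewrite erase_neq //; have [->|[-> js]] := v'P j; first by left.
by right; split=> // -[].
Qed.

Lemma finite_approximation (a : E) (e : R) : dense (unit_span E) -> 0 < e ->
  exists (b : E) (s : seq I),
    `|a - b| < e /\ forall j, ~ List.In j s -> b j = 0.
Proof.
move=> E_dense e0.
have ne : ball a e !=set0 by exists a; exact: ballxx.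
have [b [ab [n [c [i bE]]]]] := E_dense _ ne (ball_open a e).
exists b, [seq i k | k <- enum 'I_n].
split; first by move: ab; rewrite -ball_normE.
move=> j js; rewrite bE; apply: (big_ind (fun d : E => d j = 0)) => //.
  by move=> d d' dj d'j;
    rewrite [(d + d') j](_ : _ = d j + d' j) // dj d'j addr0.
move=> k _; rewrite [(_ *: _ : E) j](_ : _ = c k * \1_[set i k] j) //.
rewrite /indic memNset ?mulr0 // => jk; apply: js; rewrite jk.
have : k \in enum 'I_n by rewrite mem_enum.
elim: (enum 'I_n) => // l r IH; rewrite inE => /orP[/eqP->|/IH];
  [left|right] => //.
Qed.

(** * The dominating functional *)

Definition solid_sup (f : Z -> R) (a : E) : R :=
  sup [set f z | z in [set z : Z | forall i, `|z i| <= a i]].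

Section Dominating.
Variables (f : {linear Z -> R^o}) (fc : contractive f).
Local Notation p := (solid_sup f).
Let nonneg (a : E) := forall i, 0 <= a i.

Let has_sup_p (a : E) : nonneg a ->
  has_sup [set f z | z in [set z : Z | forall i, `|z i| <= a i]].
Proof.
move=> a0; split; first by exists (f 0); exists 0 => //= i; rewrite normr0.
exists `|a| => _ [z /= za <-]; rewrite (le_trans (fc z)) //.
by apply: asum_norm_le => i; rewrite (le_trans (za i)) // ler_norm.
Qed.

Lemma le_solid_sup (a : E) (z : Z) : (forall i, `|z i| <= a i) -> f z <= p a.
Proof.
move=> za; have a0 : nonneg a by move=> i; exact: le_trans (za i).
by apply: (ub_le_sup (has_sup_p a0).2); exists z.
Qed.

Let p_le (a : E) c : nonneg a ->
  (forall z : Z, (forall i, `|z i| <= a i) -> f z <= c) -> p a <= c.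
Proof.
move=> a0 h; apply: ge_sup; first exact: (has_sup_p a0).1.
by move=> _ [z /= za <-]; exact: h.
Qed.

Let p_le_norm (a : E) : nonneg a -> p a <= `|a|.
Proof.
move=> a0; apply: p_le => // z za; rewrite (le_trans (fc z)) //.
by apply: asum_norm_le => i; rewrite (le_trans (za i)) // ler_norm.
Qed.

Let p_ge0 (a : E) : nonneg a -> 0 <= p a.
Proof.
by move=> a0; rewrite -(linear0 f); apply: le_solid_sup => i; rewrite normr0.
Qed.

Let p0 : p 0 = 0.
Proof.
apply/eqP; rewrite eq_le p_ge0 // andbT -(normr0 E).
exact: p_le_norm.
Qed.

(** Additivity is Riesz decomposition: if [`|z i| <= a i + b i], then [z] splits
coordinatewise in the proportion [a i : b i]. *)
Let pD (a b : E) : nonneg a -> nonneg b -> p (a + b) = p a + p b.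
Proof.
move=> a0 b0; have abE i : (a + b) i = a i + b i by [].
have ab0 : nonneg (a + b) by move=> i; rewrite abE;
  exact: addr_ge0 (a0 i) (b0 i).
apply/eqP; rewrite eq_le; apply/andP; split.
  apply: p_le => // z zab.
  pose r i := a i / (a i + b i).
  have r01 i : 0 <= r i <= 1.
    have [ab|ab] := eqVneq (a i + b i) 0;
      first by rewrite /r ab invr0 mulr0 lexx ler01.
    have abp : 0 < a i + b i by rewrite lt0r ab -abE ab0.
    by rewrite /r divr_ge0 ?a0 ?(ltW abp) //= ler_pdivrMr // mul1r lerDl b0.
  have rE i : r i * (a i + b i) = a i.
    have [ab|ab] := eqVneq (a i + b i) 0; last by rewrite /r divfK.
    by rewrite ab mulr0; apply/eqP; rewrite eq_le a0 -ab lerDl b0.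
  have [z1 z1E] : exists z1 : Z, forall i, z1 i = r i *: z i.
    apply: (@asum_fun _ (pointwise_norm z)) => i /=; rewrite normr_id normrZ.
    by have /andP[r0 r1] := r01 i; rewrite ger0_norm // ler_piMl.
  have z1a i : `|z1 i| <= a i.
    have /andP[r0 r1] := r01 i.
    by rewrite z1E normrZ ger0_norm // -rE ler_wpM2l //; exact: zab.
  have z2b i : `|(z - z1) i| <= b i.
    rewrite [(z - z1) i](_ : _ = z i - z1 i) // z1E -{1}[z i]scale1r -scalerBl.
    have /andP[r0 r1] := r01 i.
    rewrite normrZ ger0_norm ?subr_ge0 //.
    apply: (@le_trans _ _ ((1 - r i) * (a i + b i))).
      by rewrite ler_wpM2l ?subr_ge0 //; exact: zab.
    by rewrite mulrBl rE mul1r addrC addKr.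
  by rewrite -(subrK z1 z) linearD addrC lerD ?le_solid_sup.
rewrite -lerBrDr; apply: p_le => // z1 z1a; rewrite lerBrDr -lerBrDl.
apply: p_le => // z2 z2b; rewrite lerBrDl -linearD; apply: le_solid_sup => i.
by rewrite abE (le_trans (ler_normD _ _)) // lerD.
Qed.

Let pZ (c : R) (a : E) : 0 <= c -> nonneg a -> p (c *: a) = c * p a.
Proof.
have caE (d : R) (b : E) i : (d *: b) i = d * b i by [].
have half (d : R) (b : E) : 0 < d -> nonneg b -> d * p b <= p (d *: b).
  move=> d0 b0; rewrite mulrC -ler_pdivlMr //; apply: p_le => // z zb.
  rewrite ler_pdivlMr // mulrC; have := @le_solid_sup (d *: b) (d *: z).
  rewrite linearZ; apply => i; rewrite caE [(d *: z) i](_ : _ = d *: z i) //.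
  by rewrite normrZ gtr0_norm // ler_pM2l //; exact: zb.
rewrite le_eqVlt => /orP[/eqP<-|c0] a0; first by rewrite scale0r mul0r p0.
apply/eqP; rewrite eq_le half // andbT -ler_pdivrMl //.
have ca0 : nonneg (c *: a) by move=> i; rewrite caE mulr_ge0 // ltW.
have ci : 0 < c^-1 by rewrite invr_gt0.
by apply: le_trans (half _ _ ci ca0) _;
  rewrite scalerA mulVf ?gt_eqF // scale1r.
Qed.

Let pos_ex (a : E) : exists b : E, forall i, b i = Num.max (a i) 0.
Proof.
apply: (@abs_fun _ a) => i; rewrite /Num.max; case: ifP => // _.
by rewrite normr0.
Qed.

Let pos (a : E) : E := sval (cid (pos_ex a)).
Let posE a i : pos a i = Num.max (a i) 0.
Proof. by rewrite /pos; case: cid. Qed.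
Let pos_ge0 a : nonneg (pos a).
Proof. by move=> i; rewrite posE le_max lexx orbT. Qed.

(** A map on the positive cone that is additive and positively homogeneous
extends to the linear map [a |-> p (a^+) - p (a^-)]. The extension has norm at
most 1 because [p (a^-) >= 0] and [p (a^+) <= `|a^+| <= `|a|]. *)
Lemma dominating_functional : exists g : {linear E -> R^o},
  contractive g /\ forall a : E, (forall i, 0 <= a i) -> g a = p a.
Proof.
pose h (a : E) := p (pos a) - p (pos (- a)).
have E_ext (a b : E) : (forall i, a i = b i) -> a = b.
  by move=> ab; apply/val_inj/funext => i; exact: ab.
have DE (a b : E) i : (a + b) i = a i + b i by [].
have NE (a : E) i : (- a) i = - a i by [].
have ZE (c : R) (a : E) i : (c *: a) i = c * a i by [].
have maxN (r : R) : Num.max r 0 = Num.max (- r) 0 + r.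
  by rewrite addr_maxl addNr add0r maxC.
have hD a b : h (a + b) = h a + h b.
  have := congr1 p (_ : pos (a + b) + pos (- a) + pos (- b) =
                        pos (- (a + b)) + pos a + pos b).
  rewrite !pD //; try by move=> i; rewrite DE addr_ge0 ?pos_ge0.
  rewrite /h => H; suff /H : pos (a + b) + pos (- a) + pos (- b) =
                        pos (- (a + b)) + pos a + pos b by lra.
  apply: E_ext => i; rewrite !DE !posE !NE !DE.
  rewrite (maxN (a i + b i)) (maxN (a i)) (maxN (b i)).
  by ring.
have hN a : h (- a) = - h a by rewrite /h opprK opprB.
have hZ0 c a : 0 <= c -> h (c *: a) = c * h a.
  move=> c0.
  have posZ b : pos (c *: b) = c *: pos b.
    apply: E_ext => i; rewrite ZE !posE ZE -[X in Num.max _ X](mulr0 c).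
    by rewrite maxr_pMr.
  by rewrite /h -scalerN !posZ !pZ // mulrBr.
have hZ c a : h (c *: a) = c * h a.
  have [c0|c0] := leP 0 c; first exact: hZ0.
  by rewrite -[c]opprK scaleNr hN hZ0 ?mulNr // oppr_ge0 ltW.
have [g gE] : exists g : {linear E -> R^o}, forall a, g a = h a.
  by apply: linear_functional_exists => c a b; rewrite hD hZ.
exists g; split=> a.
  rewrite gE /h lerBlDr (@le_trans _ _ `|a|) ?lerDl ?p_ge0 //.
  apply: (le_trans (p_le_norm (pos_ge0 a))); apply: abs_norm_le => i.
  by rewrite posE /Num.max; case: ifP; rewrite ?normr0.
move=> a0; rewrite gE /h.
have -> : pos a = a by apply: E_ext => i; rewrite posE; apply/max_idPl.
have -> : pos (- a) = 0.
  by apply: E_ext => i; rewrite posE; apply/max_idPr; rewrite NE oppr_le0.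
by rewrite p0 subr0.
Qed.

Lemma solid_sup_gt (a : E) c : (forall i, 0 <= a i) -> c < p a ->
  exists z : Z, (forall i, `|z i| <= a i) /\ c < f z.
Proof.
by move=> a0 /(sup_gt (has_sup_p a0).1)[_ [z za <-] cz]; exists z.
Qed.

End Dominating.

(** * From the summands to the sum *)

Section UniformSum.
Context (K : Type) (f : K -> {linear Z -> R^o}).
Hypothesis fc : forall k, contractive (f k).
Hypothesis E_dense : dense (unit_span E).
Hypothesis hE : uniform_acs K E.
Hypothesis hX : forall i, uniform_acs K (X i).

(** The property of [E], applied to the functionals that dominate the [h k], in
a form that speaks of the sum only: if [h k] is close to 1 at [u], then it is
also close to 1 at some family dominated by [a]. *)
Lemma sum_transfer (h : K -> {linear Z -> R^o}) (a : E) (e : R) :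
  (forall k, contractive (h k)) -> (forall i, 0 <= a i) -> `|a| <= 1 -> 0 < e ->
  exists2 d : R, 0 < d & forall k (u : Z), `|u| <= 1 ->
    2 - d < `|pointwise_norm u + a| -> 1 - d < h k u ->
    exists z : Z, (forall i, `|z i| <= a i) /\ 1 - e < h k z.
Proof.
move=> hc a0 a1 e0.
have /choice[g gP] k := dominating_functional (hc k).
have gc k : contractive (g k) by have [] := gP k.
have gE k (b : E) : (forall i, 0 <= b i) -> g k b = solid_sup (h k) b.
  by have [_] := gP k; apply.
have [d d0 hd] := hE gc a1 e0; exists d => // k u u1 ua hu.
apply: (solid_sup_gt (hc k) a0); rewrite -gE //.
apply: (hd k (pointwise_norm u)) => //; apply: (lt_le_trans hu).
rewrite gE; last by move=> i; exact: normr_ge0.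
exact: le_solid_sup.
Qed.

(** If [`|u i|] is small, then erasing the [i]-th coordinate hardly changes
[f k u]. So there is [z], dominated by [x] and vanishing at [i], with
[f k z] close to 1, and [`|z + single w| <= `|x| <= 1] bounds
[f k (single w)]. *)
Lemma small_coordinate (x : Z) i (e : R) : `|x| <= 1 -> 0 < e ->
  exists2 d : R, 0 < d & forall k (u : Z), `|u| <= 1 ->
    2 - d < `|u + x| -> 1 - d < f k u -> `|u i| <= d ->
    forall w : X i, `|w| <= `|x i| -> f k (single w) < e.
Proof.
move=> x1 e0.
have /choice[h hP] k := @contractive_erase (f k) i (fc k).
have hc k : contractive (h k) by have [] := hP k.
have hE' k z : h k z = f k (erase i z) by have [] := hP k.
have [d d0 hd] := @sum_transfer h (pointwise_norm x) e hc
  (fun i => normr_ge0 (x i)) x1 e0.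
exists (d / 2) => [|k u u1 ux fu ui w wx]; first by rewrite divr_gt0.
have [||z [zx hz]] := hd k u u1.
- by apply: lt_le_trans (norm_pointwiseD u x); lra.
- have := fc k (single (u i)); have := norm_single (u i).
  by rewrite hE' /erase linearB; move: fu ui => /=; lra.
have : f k (erase i z + single w) <= 1.
  apply: le_trans (fc k _) (le_trans _ x1).
  apply: (@asum_norm_le _ (pointwise_norm x)) => j; rewrite [leRHS]normr_id.
  rewrite [(erase i z + single w) j](_ : _ = erase i z j + single w j) //.
  have [<-|ij] := pselect (i = j); first by rewrite erase_eq single_eq add0r.
  by rewrite erase_neq // single_neq // addr0; exact: zx.
by rewrite linearD; move: hz; rewrite hE' /=; lra.
Qed.

(** Lowering the [i]-th coordinate of the norms of [x] by [r] gives [a] with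
[`|u j + x j| <= `|u j| + a j] for all [j]. So there is [z] dominated by [a]
with [f k z] close to 1. Its [i]-th coordinate may still be changed by any
vector of norm at most [r], and this bounds [f k] on the ball of radius [r] of the
[i]-th summand; the factor [r / `|x i|] in the proof rescales that ball to
radius [`|x i|]. *)
Lemma nonaligned_coordinate (x : Z) i (r e : R) : `|x| <= 1 -> 0 < e ->
  0 < r -> r <= `|x i| ->
  exists2 d : R, 0 < d & forall k (u : Z), `|u| <= 1 ->
    2 - d < `|u + x| -> 1 - d < f k u -> `|u i + x i| <= `|u i| + `|x i| - r ->
    forall w : X i, `|w| <= `|x i| -> f k (single w) < e.
Proof.
move=> x1 e0 r0 rx.
pose a : E := pointwise_norm x - r *: unit_vector E i.
have M0 : 0 < `|x i| by exact: lt_le_trans rx.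
have ai : a i = `|x i| - r.
  rewrite [a i](_ : _ = `|x i| - r * \1_[set i] i) //.
  by rewrite /indic mem_set //= mulr1.
have aj j : i <> j -> a j = `|x j|.
  move=> ij; rewrite [a j](_ : _ = `|x j| - r * \1_[set i] j) //.
  by rewrite /indic memNset /= ?mulr0 ?subr0 // => /esym.
have a0 j : 0 <= a j.
  have [<-|ij] := pselect (i = j); first by rewrite ai subr_ge0.
  by rewrite aj.
have ax j : a j <= `|x j|.
  have [<-|ij] := pselect (i = j); last by rewrite aj.
  by rewrite ai; lra.
have a1 : `|a| <= 1.
  apply: le_trans x1; apply: (@abs_norm_le _ (pointwise_norm x)) => j.
  by rewrite ger0_norm // [leRHS]normr_id.
have e'0 : 0 < e * r / `|x i| by rewrite divr_gt0 // mulr_gt0.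
have [d d0 hd] := sum_transfer fc a0 a1 e'0.
exists d => // k u u1 ux fu uxi w wx.
have ua : 2 - d < `|pointwise_norm u + a|.
  apply: (lt_le_trans ux); apply: asum_norm_le => j.
  rewrite [(u + x) j](_ : _ = u j + x j) //.
  rewrite [(pointwise_norm u + a) j](_ : _ = `|u j| + a j) //.
  rewrite [leRHS]ger0_norm; last by rewrite (addr_ge0 (normr_ge0 _) (a0 j)).
  have [<-|ij] := pselect (i = j); first by rewrite ai addrA.
  by rewrite aj //; exact: ler_normD.
have [z [za hz]] := hd k u u1 ua fu.
pose v := (r / `|x i|) *: w.
have vr : `|v| <= r.
  rewrite normrZ ger0_norm; last by rewrite divr_ge0 ?ltW.
  by rewrite mulrAC ler_pdivrMr // ler_pM2l.
have : f k (z + single v) <= 1.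
  apply: le_trans (fc k _) (le_trans _ x1).
  apply: (@asum_norm_le _ (pointwise_norm x)) => j; rewrite [leRHS]normr_id.
  rewrite [(z + single v) j](_ : _ = z j + single v j) //.
  have [<-|ij] := pselect (i = j).
    rewrite single_eq (le_trans (ler_normD _ _)) //.
    by have := za i; rewrite ai; move: vr; lra.
  by rewrite single_neq // addr0 -aj.
rewrite [single _]linearZ linearD linearZ /= => fz.
have : (r / `|x i|) *: f k (single w) < e * r / `|x i|.
  by move: fz hz => /=; lra.
by rewrite /GRing.scale /= -[e * r / _]mulrA (mulrC e) ltr_pM2l ?divr_gt0.
Qed.

(** The three cases are those of the introduction, with [X i] entering through
the normalized restrictions [phi k] of [f k]. *)
Lemma coordinate_norming (x : Z) i (e : R) : `|x| <= 1 -> 0 < e ->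
  exists2 d : R, 0 < d & forall k (u : Z), `|u| <= 1 ->
    2 - d < `|u + x| -> 1 - d < f k u ->
    forall w : X i, `|w| <= `|x i| -> f k (single w) <= f k (single (x i)) + e.
Proof.
move=> x1 e0.
have [xi0|xi0] := eqVneq (x i) 0.
  exists 1 => // k u _ _ _ w; rewrite xi0 normr0 normr_le0 => /eqP->.
  by rewrite lerDl ltW.
have M0 : 0 < `|x i| by rewrite normr_gt0.
have M1 : `|x i| <= 1 by exact: le_trans (asum_coord_le x i) x1.
have e20 : 0 < e / 2 by rewrite divr_gt0.
(* If [f k] is small on the whole ball, then so is the difference of two
   values, whatever [u] is. *)
have small k (w : X i) :
    (forall v : X i, `|v| <= `|x i| -> f k (single v) <= e / 2) ->
    `|w| <= `|x i| -> f k (single w) <= f k (single (x i)) + e.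
  move=> h wx; have := h _ wx; have := h (- x i);
    rewrite normrN lexx => /(_ isT).
  by rewrite !linearN /=; lra.
have /choice[h hP] k := @contractive_single (f k) i (fc k).
have hc k : contractive (h k) by have [] := hP k.
have hE' k w : h k w = f k (single w) by have [] := hP k.
pose b k := dual_norm (h k).
have hb k w : h k w <= b k * `|w| by apply/ler_dual_norm/contractive_has_sup.
have b1 k : b k <= 1 by exact: dual_norm_le1.
have b0 k : 0 <= b k by exact: dual_norm_ge0.
have /choice[phi phiP] k := dual_norm_normalize (hc k).
have phic k : contractive (phi k) by have [] := phiP k.
have phiE k w : phi k w = (b k)^-1 * h k w by have [] := phiP k.
have nv : `| `|x i|^-1 *: x i| <= 1.
  by rewrite normrZ normfV normr_id mulVf ?gt_eqF.
have [d3 d30 hd3] := hX phic nv e0.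
have [d2 d20 hd2] := small_coordinate i x1 e20.
pose m := Num.min d2 `|x i|.
have m0 : 0 < m by rewrite lt_min d20.
pose r := Num.min `|x i| (d3 * m).
have r0 : 0 < r by rewrite lt_min M0 mulr_gt0.
have rM : r <= `|x i| by rewrite ge_min lexx.
have rd : r / m <= d3 by rewrite ler_pdivrMr // ge_min lexx orbT.
have [d1 d10 hd1] := nonaligned_coordinate x1 e20 r0 rM.
(* In the last case [`|u i| >= m] and [b k] exceeds [e / 2]; an error of
   [d4] in [f k u] then costs less than [d3] after division by [b k * `|u i|]. *)
pose d4 := d3 * (e / 2 * m).
have d40 : 0 < d4 by rewrite !mulr_gt0.
pose d := Num.min (Num.min d1 d2) d4.
have dd1 : d <= d1 by rewrite /d !ge_min lexx.
have dd2 : d <= d2 by rewrite /d !ge_min lexx orbT.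
have dd4 : d <= d4 by rewrite /d !ge_min lexx !orbT.
exists d; first by rewrite !lt_min d10 d20.
move=> k u u1 ux fu w wx.
have [um|um] := leP `|u i| d2.
  apply: small => // v vx; apply/ltW/(hd2 k u) => //; lra.
have [uxr|uxr] := leP `|u i + x i| (`|u i| + `|x i| - r).
  apply: small => // v vx; apply/ltW/(hd1 k u) => //; lra.
have [be|be] := leP (b k) (e / 2).
  apply: small => // v vx; rewrite -hE' (le_trans (hb _ _)) //.
  apply: le_trans be; rewrite ler_piMr // (le_trans vx) //.
have u0 : 0 < `|u i| by exact: lt_trans um.
have bp : 0 < b k by exact: lt_trans be.
have mu : m <= `|u i| by rewrite ge_min (ltW um).
have mx : m <= `|x i| by rewrite ge_min lexx orbT.
pose U := `|u i|^-1 *: u i.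
have U1 : `|U| <= 1 by rewrite normrZ normfV normr_id mulVf ?gt_eqF.
(* Replacing [u i] by a vector that is not longer keeps [u] in the unit ball, so
   it raises the value of [f k] by at most [1 - f k u]. *)
have bu : b k * `|u i| <= h k (u i) + (1 - f k u).
  apply: dual_norm_ler => // v vu.
  have : f k (u - single (u i) + single v) <= 1.
    apply: le_trans (fc k _) (le_trans _ u1).
    apply: (@asum_norm_le _ (pointwise_norm u)) => j; rewrite [leRHS]normr_id.
    rewrite [(u - single (u i) + single v) j](_ :
      _ = erase i u j + single v j) //.
    have [<-|ij] := pselect (i = j); first by rewrite erase_eq single_eq add0r.
    by rewrite erase_neq // single_neq // addr0.
  by rewrite linearD linearB !hE' /=; lra.
have : 1 - e < phi k (`|x i|^-1 *: x i).
  apply: (hd3 k U) => //.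
    have := normalized_sum_ge m0 mu mx; apply: lt_le_trans.
    rewrite ltrD2l ltrN2 (lt_le_trans _ rd) // ltr_pM2r ?invr_gt0 //; lra.
  rewrite phiE linearZ /= /GRing.scale /= mulrA -invfM mulrC ltr_pdivlMr;
    last exact: mulr_gt0.
  apply: (@lt_le_trans _ _ (b k * `|u i| - d)); last lra.
  rewrite mulrBl mul1r ltrD2l ltrN2; apply: (le_lt_trans dd4).
  rewrite /d4 ltr_pM2l //; apply: (@lt_le_trans _ _ (b k * m));
    first by rewrite ltr_pM2r.
  by rewrite ler_pM2l.
rewrite phiE linearZ /= /GRing.scale /= mulrA -invfM mulrC ltr_pdivlMr;
  last exact: mulr_gt0.
rewrite hE' => hx; rewrite -hE'.
apply: (le_trans (hb k w)); apply: (@le_trans _ _ (b k * `|x i|));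
  first by rewrite ler_wpM2l.
have : e * (b k * `|x i|) <= e.
  by rewrite ger_pMr // mulr_ile1 // ltW.
by move: hx; rewrite mulrBl mul1r; lra.
Qed.

(** Passing from [z], at which [f k] is almost norming, to [x] changes the value
by the contributions of the coordinates in [s] and a remainder. The three
quantities that separate [f k x] from 1 (the defect at [z], these coordinates,
and the remainder, which is dominated by [2 * `|x j|] off [s]) are each at
most [e / 4]. *)
Lemma sum_uniform_acs_along (x : Z) (e : R) : `|x| <= 1 -> 0 < e ->
  exists2 d : R, 0 < d & forall k (u : Z), `|u| <= 1 ->
    2 - d < `|u + x| -> 1 - d < f k u -> 1 - e < f k x.
Proof.
move=> x1 e0.
have e8 : 0 < e / 8 by rewrite divr_gt0.
have e4 : 0 < e / 4 by rewrite divr_gt0.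
have [b [s [xb bs]]] := finite_approximation (pointwise_norm x) E_dense e8.
have [d0 d00 hd0] := @sum_transfer f (pointwise_norm x) _ fc
  (fun i => normr_ge0 (x i)) x1 e4.
pose c := e / 4 / (size s).+1%:R.
have c0 : 0 < c by rewrite divr_gt0.
have [d1 d10 hd1] : exists2 d : R, 0 < d & forall k (u : Z), `|u| <= 1 ->
    2 - d < `|u + x| -> 1 - d < f k u -> forall i, List.In i s ->
    forall w : X i, `|w| <= `|x i| -> f k (single w) <= f k (single (x i)) + c.
  clear bs; clearbody c; elim: s => [|i s [d d_gt0 hd]]; first by exists 1.
  have [d' d'0 hd'] := coordinate_norming i x1 c0.
  exists (Num.min d d') => [|k u u1 ux fu j]; first by rewrite lt_min d_gt0.
  have dd : Num.min d d' <= d by rewrite ge_min lexx.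
  have dd' : Num.min d d' <= d' by rewrite ge_min lexx orbT.
  by move=> [<-|js]; [apply: (hd' k u)|apply: (hd k u)] => //; lra.
exists (Num.min d0 d1) => [|k u u1 ux fu]; first by rewrite lt_min d00.
have dd0 : Num.min d0 d1 <= d0 by rewrite ge_min lexx.
have dd1 : Num.min d0 d1 <= d1 by rewrite ge_min lexx orbT.
have [||z [zx fz]] := hd0 k u u1.
- by apply: lt_le_trans (norm_pointwiseD u x); lra.
- by lra.
have [||v [fv vP]] := @finite_coordinates (f k) s (z - x) c; first exact: ltW.
  move=> i si; rewrite [(z - x) i](_ : _ = 1 *: z i - x i) ?scale1r //.
  by rewrite !linearB /= lerBlDl; apply: (hd1 k u) => //; lra.
have v4 : `|v| <= e / 4.
  apply: (@le_trans _ _ `|2 *: (pointwise_norm x - b)|); last first.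
    by rewrite normrZ ger0_norm //; lra.
  apply: asum_norm_le => j.
  have [->|[-> /bs bj]] := vP j; first by rewrite normr0.
  rewrite [(_ *: _ : E) j](_ : _ = 2 * (`|x j| - b j)) // bj subr0.
  rewrite [leRHS]ger0_norm ?mulr_ge0 // [(z - x) j](_ : _ = z j - x j) //.
  by rewrite (le_trans (ler_normB _ _)) // mulr_natl mulr2n lerD2r; exact: zx.
have sc : (size s)%:R * c <= e / 4.
  by rewrite /c mulrCA ger_pMr // ler_pdivrMr // mul1r ler_nat.
have := fc k v; move: fv; rewrite linearB /=; lra.
Qed.

End UniformSum.

Theorem sum_uniform_acs (K : Type) : dense (unit_span E) ->
  uniform_acs K E -> (forall i, uniform_acs K (X i)) ->
  uniform_acs K (absolute_sum E X).
Proof. by move=> dE hE hX f fc x x1 e e0; exact: sum_uniform_acs_along. Qed.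

End Sum.

Theorem proposition3p6 (R : realType) (I : Type) (I_neq0 : [set: I] !=set0)
    (E : absolute_space R I) (E_dense : dense (unit_span E))
    (X : I -> completeNormedModType R) :
  ((forall i, sluacs (X i)) -> sluacs_plus E -> sluacs (absolute_sum E X)) /\
  ((forall i, luacs (X i)) -> luacs_plus E -> luacs (absolute_sum E X)).
Proof.
split=> hX hE.
- apply/uniform_acs_sluacs/sum_uniform_acs => // [|i].
    apply: sluacs_uniform_acs => x u f sx su sf ux fu.
    by apply/(hE x u).
  exact: sluacs_uniform_acs.
- apply/uniform_acs_luacs/sum_uniform_acs => // [|i].
    apply: luacs_uniform_acs => x u f sx su sf ux fu.
    by apply/(hE x u).
  exact: luacs_uniform_acs.
Qed.
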